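(* Let $f$ be convex on $\mathcal{X}=\mathcal{X}_1\times\cdots\times\mathcal{X}_{N_b}$, let $\alpha=B/N_b$, and let $\{\gamma_t\}_{t=0,1,\ldots}$ be a predefined (deterministic) step-size sequence satisfying, for all $t\ge 0$, $$0<\gamma_t\le 1,\qquad \frac{1-\alpha\gamma_{t+1}}{\gamma_{t+1}^2}\le \frac{1}{\gamma_t^2},\qquad \gamma_{t+1}\le\gamma_t .$$ Let $\{\mathbf{x}^t\}$ be generated by the randomized block Frank-Wolfe algorithm with step sizes $\{\gamma_t\}$. Then for every $t\ge 1$ and every $K\in\{1,\ldots,t\}$, $$g_t\le \frac{\mathbb{E}\left[h(\mathbf{x}^K)\right]}{\alpha(t-K+1)\gamma_t}+\frac{\bar C_f^{B}\,\gamma_K^2}{2\alpha\gamma_t},$$ where $g_t:=\min_{k\in\{0,1,\ldots,t\}}\mathbb{E}[g(\mathbf{x}^k)]$.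
   Context: Setting. $N_b\ge 1$ is an integer, $\mathcal{N}_b=\{1,\ldots,N_b\}$, $B\in\{1,\ldots,N_b\}$, $\alpha:=B/N_b$. Vectors $\mathbf{x}\in\mathbb{R}^d$ are split into blocks $\mathbf{x}=(\mathbf{x}_1,\ldots,\mathbf{x}_{N_b})$. The feasible set is $\mathcal{X}=\mathcal{X}_1\times\cdots\times\mathcal{X}_{N_b}$, with each $\mathcal{X}_n$ nonempty, convex and compact. The objective $f$ is real-valued and differentiable on (an open set containing) $\mathcal{X}$; $\nabla_{\mathbf{x}_n}f$ denotes the partial gradient with respect to block $n$. The problem is to minimize $f$ over $\mathcal{X}$; $\mathbf{x}^*$ is a global minimizer of $f$ over $\mathcal{X}$, and $h(\mathbf{x}):=f(\mathbf{x})-f(\mathbf{x}^* )$. The duality gap is $g(\mathbf{x}):=\sup_{\mathbf{s}\in\mathcal{X}}(\mathbf{x}-\mathbf{s})^\top\nabla f(\mathbf{x})$ for $\mathbf{x}\in\mathcal{X}$. Randomized block Frank-Wolfe algorithm. Start from a (deterministic) $\mathbf{x}^0\in\mathcal{X}$. At iteration $t=0,1,\ldots$: draw $\mathcal{B}_t$ uniformly at random among all subsets of $\mathcal{N}_b$ with exactly $B$ elements, independently of previous draws; for each $n\in\mathcal{B}_t$ pick a minimizer $\mathbf{s}_n^t\in\arg\min_{\mathbf{s}_n\in\mathcal{X}_n}\langle \mathbf{s}_n,\nabla_{\mathbf{x}_n}f(\mathbf{x}^t)\rangle$ (ties broken arbitrarily, as a function of the draws $\mathcal{B}_0,\ldots,\mathcal{B}_t$);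 set $\mathbf{x}_n^{t+1}=(1-\gamma_t)\mathbf{x}_n^t+\gamma_t\mathbf{s}_n^t$ for $n\in\mathcal{B}_t$ and $\mathbf{x}_n^{t+1}=\mathbf{x}_n^t$ for $n\notin\mathcal{B}_t$. Expectations are over the random draws. Curvature. For $\mathcal{B}\subseteq\mathcal{N}_b$, $$C_f^{\mathcal{B}}:=\sup \frac{2}{\gamma^2}\Big(f(\mathbf{y})-f(\mathbf{x})-\sum_{n\in\mathcal{B}}\langle\mathbf{y}_n-\mathbf{x}_n,\nabla_{\mathbf{x}_n}f(\mathbf{x})\rangle\Big),$$ the supremum being over $\gamma\in(0,1]$, $\mathbf{x}\in\mathcal{X}$, $\mathbf{s}_n\in\mathcal{X}_n$ ($n\in\mathcal{B}$), where $\mathbf{y}_n=(1-\gamma)\mathbf{x}_n+\gamma\mathbf{s}_n$ for $n\in\mathcal{B}$ and $\mathbf{y}_n=\mathbf{x}_n$ otherwise. The expected set curvature is $\bar C_f^{B}:=\binom{N_b}{B}^{-1}\sum_{\mathcal{B}\subseteq\mathcal{N}_b,\,|\mathcal{B}|=B}C_f^{\mathcal{B}}$. It is assumed throughout that $C_f:=C_f^{\mathcal{N}_b}$ is finite (hence so are all $C_f^{\mathcal{B}}$ and $\bar C_f^{B}$). *)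

(* Defs.v *)
From HB Require Import structures.
From mathcomp Require Import all_boot all_order all_algebra.
From mathcomp Require Import all_classical all_reals all_analysis.

Set Implicit Arguments.
Unset Strict Implicit.
Unset Printing Implicit Defensive.

Import Order.TTheory GRing.Theory Num.Theory.
Import numFieldNormedType.Exports.

Local Open Scope classical_set_scope.
Local Open Scope ring_scope.

Definition inner {R : realType} {m : nat} (u v : 'rV[R]_m) : R :=
  \sum_(i < m) u 0 i * v 0 i.

Definition gradient {R : realType} {m : nat} (f : 'rV[R]_m -> R)
    (x : 'rV[R]_m) : 'rV[R]_m :=
  \row_(i < m) 'D_(delta_mx 0 i) (f : _ -> R^o) x.

Section BlockFrankWolfe.
Context {R : realType} {Nb : nat} {d : 'I_Nb -> nat}.

(* A point of the ambient space is a row of total width \sum_n d n, and its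
   n-th block is submxrow x n. *)
Local Notation vec := 'rV[R]_(\sum_(n < Nb) d n).

Definition partial_gradient (f : vec -> R) (x : vec) (n : 'I_Nb) :
  'rV[R]_(d n) := submxrow (gradient f x) n.

Definition feasible (Xb : forall n : 'I_Nb, set 'rV[R]_(d n)) : set vec :=
  [set x | forall n, Xb n (submxrow x n)].

Definition block_step (S : {set 'I_Nb}) (g : R) (x : vec)
    (s : forall n : 'I_Nb, 'rV[R]_(d n)) : vec :=
  \mxrow_n (if n \in S then (1 - g) *: submxrow x n + g *: s n
            else submxrow x n).

(* The real supremum [sup] is only meaningful for a nonempty bounded set;
   this is the case at every x as soon as all the blocks Xb n are nonempty and
   compact. *)
Definition duality_gap (Xb : forall n : 'I_Nb, set 'rV[R]_(d n))
    (f : vec -> R) (x : vec) : R :=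
  sup [set inner (x - s) (gradient f x) | s in feasible Xb].

Definition set_curvature (Xb : forall n : 'I_Nb, set 'rV[R]_(d n))
    (f : vec -> R) (S : {set 'I_Nb}) : \bar R :=
  ereal_sup [set c | exists g x s,
    [/\ 0 < g <= 1, feasible Xb x, (forall n, n \in S -> Xb n (s n)) &
        let y := block_step S g x s in
        c = (2 / g ^+ 2 *
             (f y - f x - \sum_(n in S)
                inner (submxrow y n - submxrow x n)
                      (partial_gradient f x n)))%:E]].

Definition expected_curvature (Xb : forall n : 'I_Nb, set 'rV[R]_(d n))
    (f : vec -> R) (B : nat) : \bar R :=
  ((('C(Nb, B))%:R^-1 : R)%:E *
   \sum_(S : {set 'I_Nb} | #|S| == B) set_curvature Xb f S)%E.

Definition is_argmin (V : Type) (A : set V) (F : V -> R) (v : V) : Prop :=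
  A v /\ forall u, A u -> F v <= F u.

(* The finite type I carries its discrete sigma-algebra, so the product rule
   ranges over all subsets A i. *)
Definition mutually_independent {disp : measure_display}
    {T : measurableType disp} (P : probability T R) (I : finType)
    (X : nat -> T -> I) : Prop :=
  forall (J : seq nat) (A : nat -> set I), uniq J ->
    P (\bigcap_(i in [set` J]) (X i @^-1` A i)) =
    (\big[*%E/1]_(i <- J) P (X i @^-1` A i))%E.

Definition uniform_draws {disp : measure_display} {T : measurableType disp}
    (P : probability T R) (B : nat) (draw : nat -> T -> {set 'I_Nb}) : Prop :=
  [/\ forall t S, measurable (draw t @^-1` [set S]),
      forall t S, P (draw t @^-1` [set S]) =
        (if #|S| == B then (('C(Nb, B))%:R^-1 : R)%:E else 0%E) &
      mutually_independent P draw].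

(* [s t w n] is the linear minimizer chosen for block n at iteration t; it is
   only constrained, and only used, for n \in draw t w. The third condition
   says that the choice is a function of draw 0, ..., draw t. *)
Definition randomized_block_FW {T : Type}
    (Xb : forall n : 'I_Nb, set 'rV[R]_(d n)) (f : vec -> R)
    (gamma : nat -> R) (x0 : vec) (draw : nat -> T -> {set 'I_Nb})
    (s : nat -> T -> forall n : 'I_Nb, 'rV[R]_(d n))
    (x : nat -> T -> vec) : Prop :=
  [/\ forall w, x 0%N w = x0,
      forall t w n, n \in draw t w ->
        is_argmin (Xb n) (fun u => inner u (partial_gradient f (x t w) n))
          (s t w n),
      forall t w w', (forall i, (i <= t)%N -> draw i w = draw i w') ->
        forall n, n \in draw t w -> s t w n = s t w' n &
      forall t w, x t.+1 w = block_step (draw t w) (gamma t) (x t w) (s t w)].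

End BlockFrankWolfe.

(* Main.v *)
(* One step of the algorithm decreases f by gamma_k times the sum of the drawn
   block gaps, up to gamma_k^2/2 times the curvature of the drawn set. The
   iterate x^k is a function of the draws before time k, hence takes finitely
   many values and is independent of the k-th draw, which contains a given block
   with probability alpha. Taking expectations,
     E f(x^(k+1)) <= E f(x^k) - alpha gamma_k E g(x^k) + gamma_k^2/2 C.
   Summing over k = K, ..., t with gamma_t <= gamma_k <= gamma_K and g >= 0 gives
     alpha gamma_t (t-K+1) min_k E g(x^k) <= E h(x^K) + (t-K+1) gamma_K^2/2 C. *)
Require Import Defs.
From HB Require Import structures.
From mathcomp Require Import all_boot all_order all_algebra.
From mathcomp Require Import all_classical all_reals all_analysis.
From mathcomp Require Import ring lra.

Set Implicit Arguments.
Unset Strict Implicit.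
Unset Printing Implicit Defensive.

Import Order.TTheory GRing.Theory Num.Theory.
Import numFieldNormedType.Exports.

Local Open Scope classical_set_scope.
Local Open Scope ring_scope.

(** * Inner products and linear minimization over compact sets *)

Section Inner.
Context {R : realType}.

Lemma innerBl m (u v w : 'rV[R]_m) : inner (u - v) w = inner u w - inner v w.
Proof.
rewrite /inner -sumrB; apply: eq_bigr => i _.
by rewrite !mxE mulrBl.
Qed.

Lemma innerZl m a (u w : 'rV[R]_m) : inner (a *: u) w = a * inner u w.
Proof. by rewrite /inner mulr_sumr; apply: eq_bigr => i _; rewrite !mxE mulrA. Qed.

Lemma inner0l m (w : 'rV[R]_m) : inner 0 w = 0.
Proof. by rewrite -(scale0r 0) innerZl mul0r. Qed.

(** Seen as the matrix product of [u] and the transpose of [v], the inner product splits by block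
    multiplication of a row of blocks with a column of blocks. *)
Lemma inner_blocks p (q : 'I_p -> nat) (u v : 'rV[R]_(\sum_i q i)) :
  inner u v = \sum_n inner (submxrow u n) (submxrow v n).
Proof.
have innerE m (a b : 'rV[R]_m) : inner a b = (a *m b^T) 0 0.
  by rewrite mxE; apply: eq_bigr => i _; rewrite mxE.
rewrite innerE -{1}(submxrowK u) -{1}(submxrowK v) tr_mxrow mul_mxrow_mxcol.
by rewrite summxE; apply: eq_bigr => n _; rewrite innerE.
Qed.

Lemma continuous_innerl m (v : 'rV[R]_m) : continuous (fun u => inner u v).
Proof.
apply: continuous_big => [|i _ u]; first exact: add_continuous.
apply: (@cvgM _ _ (nbhs u) _ (fun u => u 0 i) (cst (v 0 i))); last exact: cvg_cst.
exact: (@coord_continuous R 1 m 0 i u).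
Qed.

(** Extreme value theorem. The algorithm provides minimizers for the drawn blocks only, whereas the
    gap estimate sums over all blocks, so an oracle for every block is built from this lemma. *)
Lemma linear_argmin_exists m (A : set 'rV[R]_m) (v : 'rV[R]_m) :
  A !=set0 -> compact A -> exists u, is_argmin A (fun u => inner u v) u.
Proof.
move=> A0 cA.
have [|u Au umin] := @EVT_min_rV R m (fun u => inner u v) A A0 cA.
  exact/continuous_subspaceT/continuous_innerl.
exists u; split; first exact: set_mem.
by move=> w Aw; apply/umin/mem_set.
Qed.

Lemma convex_setP (V : lmodType R) (A : set V) (x y : V) (a : R) :
  convex_set A -> 0 <= a <= 1 -> A x -> A y -> A ((1 - a) *: x + a *: y).
Proof.
move=> cA /andP[a0 a1] Ax Ay.
have /set_mem := cA y x (Itv01 a0 a1) (mem_set Ay) (mem_set Ax).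
by rewrite addrC.
Qed.

End Inner.

(** * Block steps, set curvature and block gaps *)

Section BlockGeometry.
Context {R : realType} {Nb : nat} {d : 'I_Nb -> nat}.
Implicit Types (Xb : forall n : 'I_Nb, set 'rV[R]_(d n)) (S : {set 'I_Nb}).
Implicit Types (f : 'rV[R]_(\sum_(n < Nb) d n) -> R).
Implicit Types (x : 'rV[R]_(\sum_(n < Nb) d n)).
Implicit Types (s : forall n : 'I_Nb, 'rV[R]_(d n)).

Lemma submxrow_block_step S a x s n : submxrow (block_step S a x s) n =
  if n \in S then (1 - a) *: submxrow x n + a *: s n else submxrow x n.
Proof. by rewrite mxrowK. Qed.

Lemma eq_block_step S a x s s' : (forall n, n \in S -> s n = s' n) ->
  block_step S a x s = block_step S a x s'.
Proof.
by move=> ss'; apply: eq_mxrow => n; case: ifPn => // nS; rewrite ss'.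
Qed.

Lemma block_step_feasible Xb S a x s : (forall n, convex_set (Xb n)) ->
  0 <= a <= 1 -> feasible Xb x -> (forall n, n \in S -> Xb n (s n)) ->
  feasible Xb (block_step S a x s).
Proof.
move=> cX a01 Xx Xs n; rewrite submxrow_block_step; case: ifPn => nS; last exact: Xx.
by apply: convex_setP => //; exact: Xs.
Qed.

Lemma submxrow_block_stepB S a x s n : n \in S ->
  submxrow (block_step S a x s) n - submxrow x n = a *: (s n - submxrow x n).
Proof.
move=> nS; rewrite submxrow_block_step nS scalerBl scale1r scalerBr.
by rewrite addrAC [_ - a *: _]addrC addrK addrC.
Qed.

(** Every competitor for [S] is one for [S']: padding the targets with the current blocks of [x]
    outside [S] leaves the step unchanged, and the additional linear terms vanish. *)
Lemma le_set_curvature Xb f S S' : S \subset S' ->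
  (set_curvature Xb f S <= set_curvature Xb f S')%E.
Proof.
move=> sSS'; apply: ge_ereal_sup => _ [a [x [s [a01 Xx Xs ->]]]].
pose s' n := if n \in S then s n else submxrow x n.
have ysE : block_step S' a x s' = block_step S a x s.
  apply: eq_mxrow => n; rewrite /s'.
  case: (boolP (n \in S)) => [nS|nS]; first by rewrite (fintype.subsetP sSS').
  by case: ifP => // _; rewrite -scalerDl subrK scale1r.
apply: ereal_sup_ubound; exists a, x, s'; split => //.
  by move=> n nS'; rewrite /s'; case: ifPn => [/Xs//|_]; exact: Xx.
rewrite /= ysE; congr (_ * (_ - _))%:E.
rewrite [RHS](finset.big_setID S)/= (finset.setIidPr sSS').
rewrite [X in _ = _ + X]big1 ?addr0// => n.
by rewrite finset.inE submxrow_block_step => /andP[/negbTE-> _]; rewrite subrr inner0l.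
Qed.

(** The step of size 1 from [x] towards its own blocks stays at [x] and contributes the value 0 to
    the supremum. *)
Lemma set_curvature_ge0 Xb f S x : feasible Xb x -> (0 <= set_curvature Xb f S)%E.
Proof.
move=> Xx; apply: ereal_sup_ubound.
exists 1, x, (fun n => submxrow x n); split => //; first by rewrite ltr01 lexx.
have -> : block_step S 1 x (fun n => submxrow x n) = x.
  apply/mxrowP => n; rewrite submxrow_block_step.
  by case: ifP => // _; rewrite -scalerDl subrK scale1r.
rewrite /= subrr big1 ?subr0 ?mulr0// => n _.
by rewrite subrr inner0l.
Qed.

Lemma set_curvature_fin_num Xb f S x : feasible Xb x ->
  set_curvature Xb f [set: 'I_Nb]%SET \is a fin_num ->
  set_curvature Xb f S \is a fin_num.
Proof.
move=> Xx Cfin; rewrite ge0_fin_numE; last exact: set_curvature_ge0 Xx.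
apply: le_lt_trans (le_set_curvature Xb f (finset.subsetT S)) _.
by rewrite -ge0_fin_numE//; exact: set_curvature_ge0 Xx.
Qed.

(** The supremum defining the curvature dominates its value at this very step; clearing the factor
    [2 / a ^+ 2] gives the estimate. *)
Lemma block_step_descent Xb f S a x s : 0 < a <= 1 -> feasible Xb x ->
  (forall n, n \in S -> Xb n (s n)) -> set_curvature Xb f S \is a fin_num ->
  f (block_step S a x s) <=
    f x - a * (\sum_(n in S) inner (submxrow x n - s n) (partial_gradient f x n))
    + a ^+ 2 / 2 * fine (set_curvature Xb f S).
Proof.
move=> /andP[a0 a1] Xx Xs Cfin.
set y := block_step S a x s.
have : ((2 / a ^+ 2 * (f y - f x - \sum_(n in S)
   inner (submxrow y n - submxrow x n) (partial_gradient f x n)))%:E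
   <= (fine (set_curvature Xb f S))%:E)%E.
  rewrite fineK//; apply: ereal_sup_ubound; exists a, x, s.
  by split => //; rewrite a0 a1.
rewrite lee_fin mulrC -ler_pdivlMr ?divr_gt0 ?exprn_gt0// invf_div => H.
have -> : a * \sum_(n in S) inner (submxrow x n - s n) (partial_gradient f x n)
   = - \sum_(n in S) inner (submxrow y n - submxrow x n) (partial_gradient f x n).
  rewrite mulr_sumr -sumrN; apply: eq_bigr => n nS.
  by rewrite submxrow_block_stepB// innerZl !innerBl -mulrN opprB.
by rewrite opprK [_ * fine _]mulrC -lerBlDl opprD addrA.
Qed.

Implicit Type lmo : forall n : 'I_Nb, 'rV[R]_(d n) -> 'rV[R]_(d n).

(** One fixed minimizer for each block and direction makes the block gaps deterministic functions of
    the point, unlike the minimizers [s], which depend on the draws. *)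
Definition linear_oracle Xb lmo :=
  forall n v, is_argmin (Xb n) (fun u => inner u v) (lmo n v).

(* With [lmo n v] a minimizer of <., v> over the n-th block, this is the n-th
   summand of the duality gap. *)
Definition block_gap lmo f x n :=
  inner (submxrow x n - lmo n (partial_gradient f x n)) (partial_gradient f x n).

Lemma block_gap_ge0 Xb lmo f x n : linear_oracle Xb lmo ->
  feasible Xb x -> 0 <= block_gap lmo f x n.
Proof.
move=> lmoP Xx; rewrite /block_gap innerBl subr_ge0.
by have [_] := lmoP n (partial_gradient f x n); apply; exact: Xx.
Qed.

(** Two minimizers give the linear form the same value, so the tie-breaking of the algorithm does
    not affect the gap. *)
Lemma block_gap_argmin Xb lmo f x n u : linear_oracle Xb lmo ->
  is_argmin (Xb n) (fun u => inner u (partial_gradient f x n)) u ->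
  inner (submxrow x n - u) (partial_gradient f x n) = block_gap lmo f x n.
Proof.
move=> lmoP [Xu umin]; rewrite /block_gap !innerBl; congr (_ - _); apply/le_anti.
have [Xl lmin] := lmoP n (partial_gradient f x n).
by rewrite umin//= lmin.
Qed.

(** The linear form splits over the blocks, and each summand is largest at the minimizer chosen by
    the oracle. *)
Lemma duality_gap_le Xb lmo f x : linear_oracle Xb lmo ->
  feasible Xb x ->
  duality_gap Xb f x <= \sum_n block_gap lmo f x n.
Proof.
(* Bounding [sup] requires a nonempty set; the feasible point [x] itself provides an element. *)
move=> lmoP Xx; apply: ge_sup; first by exists (inner (x - x) (gradient f x)), x.
move=> _ [u Xu <-]; rewrite inner_blocks; apply: ler_sum => n _.
have -> : submxrow (x - u) n = submxrow x n - submxrow u n.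
  by apply/matrixP => i j; rewrite !mxE.
rewrite -/(partial_gradient f x n) /block_gap !innerBl lerD2l lerN2.
by have [_] := lmoP n (partial_gradient f x n); apply; exact: Xu.
Qed.

End BlockGeometry.

(** * Integrals of functions of a finitely valued random variable *)

Section FinitelyValued.
Context {R : realType} {disp : measure_display} {T : measurableType disp}.
Variable P : probability T R.

(** For finite [I] this amounts to measurability into the discrete sigma-algebra. *)
Definition measurable_fibers (I : finType) (Z : T -> I) :=
  forall i, measurable (Z @^-1` [set i]).

Lemma measurable_fibers_pair (I J : finType) (Z : T -> I) (Z' : T -> J) :
  measurable_fibers Z -> measurable_fibers Z' ->
  measurable_fibers (fun w => (Z w, Z' w)).
Proof.
move=> mZ mZ' [i j].
rewrite (_ : _ @^-1` _ = Z @^-1` [set i] `&` Z' @^-1` [set j]); last first.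
  by apply/seteqP; split => w /= [-> ->].
exact: measurableI.
Qed.

Lemma finitely_valuedE (I : finType) (Z : T -> I) (F : I -> R) w :
  F (Z w) = \sum_i F i * \1_(Z @^-1` [set i]) w.
Proof.
rewrite (bigD1 (Z w))//= indicE mem_set// mulr1 big1 ?addr0// => i /eqP iZ.
by rewrite indicE memNset ?mulr0//= => /esym.
Qed.

(** A finite combination of indicators of measurable fibers is integrable whatever [F] is. Hence the
    objective and the gaps can be integrated along the iterates once the draws are measurable. *)
Lemma integrable_finitely_valued (I : finType) (Z : T -> I) (F : I -> R) :
  measurable_fibers Z -> P.-integrable setT (EFin \o (F \o Z)).
Proof.
move=> mZ.
rewrite (_ : EFin \o _ =
    fun w => (\sum_i (F i)%:E * (\1_(Z @^-1` [set i]) w)%:E)%E); last first.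
  by apply/funext => w /=; rewrite finitely_valuedE -sumEFin.
apply: integrable_sum => // i _; apply: integrableZl => //.
exact: integrable_indic.
Qed.

Lemma Rintegral_finitely_valued (I : finType) (Z : T -> I) (F : I -> R) :
  measurable_fibers Z ->
  \int[P]_w F (Z w) = \sum_i F i * fine (P (Z @^-1` [set i])).
Proof.
move=> mZ; apply: EFin_inj; rewrite fineK; last first.
  exact/integrable_fin_num/integrable_finitely_valued.
rewrite (eq_integral
    (fun w => (\sum_i (F i)%:E * (\1_(Z @^-1` [set i]) w)%:E)%E)); last first.
  by move=> w _; rewrite finitely_valuedE -sumEFin.
rewrite integral_sum//; last first.
  by move=> i; apply: integrableZl => //; exact: integrable_indic.
rewrite -sumEFin; apply: eq_bigr => i _.
rewrite integralZl//; last exact: integrable_indic.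
by rewrite integral_indic// setIT EFinM fineK// fin_num_measure.
Qed.

(** The pair of [Z] and [Z'] is again finitely valued; on its joint fibers the probabilities factor,
    and so does the double sum. *)
Lemma Rintegral_mul_independent (I J : finType) (Z : T -> I) (Z' : T -> J)
    (F : I -> R) (G : J -> R) :
  measurable_fibers Z -> measurable_fibers Z' ->
  (forall i j, P (Z @^-1` [set i] `&` Z' @^-1` [set j]) =
     (P (Z @^-1` [set i]) * P (Z' @^-1` [set j]))%E) ->
  \int[P]_w (F (Z w) * G (Z' w)) = (\int[P]_w F (Z w)) * \int[P]_w G (Z' w).
Proof.
move=> mZ mZ' PZZ'.
rewrite (Rintegral_finitely_valued (Z := fun w => (Z w, Z' w))
  (fun p => F p.1 * G p.2)); last exact: measurable_fibers_pair.
rewrite !Rintegral_finitely_valued// big_distrlr/= pair_bigA/=.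
apply: eq_bigr => -[i j] _ /=.
rewrite (_ : _ @^-1` _ = Z @^-1` [set i] `&` Z' @^-1` [set j]); last first.
  by apply/seteqP; split => w /= [-> ->].
by rewrite PZZ' fineM ?fin_num_measure// mulrACA.
Qed.

Lemma Rintegral_sum (I : finType) (X : I -> T -> R) :
  (forall i, P.-integrable setT (EFin \o X i)) ->
  \int[P]_w (\sum_i X i w) = \sum_i \int[P]_w X i w.
Proof.
move=> iX; apply: EFin_inj; rewrite fineK; last first.
  apply: integrable_fin_num => //.
  rewrite [X in integrable _ _ X](_ : _ = fun w => (\sum_i (X i w)%:E)%E); last first.
    by apply/funext => w /=; rewrite sumEFin.
  by apply: integrable_sum => // i _; exact: iX.
under eq_integral do rewrite -sumEFin.
rewrite integral_sum// -sumEFin; apply: eq_bigr => i _.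
by rewrite fineK//; exact: (integrable_fin_num _ (iX i)).
Qed.

Lemma expectation_Rintegral (X : T -> R) :
  P.-integrable setT (EFin \o X) -> 'E_P[X]%E = (\int[P]_w X w)%:E.
Proof. by move=> iX; rewrite unlock fineK//; exact: integrable_fin_num. Qed.

End FinitelyValued.

(** * Functions of the past draws *)

Section Histories.
Context {R : realType} {Nb : nat} {T : Type} (draw : nat -> T -> {set 'I_Nb}).

Definition history k w : {ffun 'I_k -> {set 'I_Nb}} := [ffun i : 'I_k => draw i w].

(** The inequality is strict because [x k] is fixed before draw [k] is made; this is what makes it
    independent of that draw. *)
Definition adapted (V : Type) k (X : T -> V) := forall w w',
  (forall i, (i < k)%N -> draw i w = draw i w') -> X w = X w'.

Lemma adapted_history k (X : T -> R) : adapted k X ->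
  exists F, X = F \o history k.
Proof.
move=> aX.
(* On a history that occurs, [cid] picks some outcome producing it, and adaptedness makes the choice
   immaterial; 0 is a default for histories that never occur. *)
exists (fun h => if pselect (exists w, history k w = h) is left e
                 then X (projT1 (cid e)) else 0).
apply/funext => w /=; case: pselect => [e|]; last by case; exists w.
case: cid => w' /= ww'; apply: aX => i ik.
by have /ffunP/(_ (Ordinal ik)) := ww'; rewrite !ffunE.
Qed.

(** Puts the event in the form of an intersection over a list of times, as in
    [mutually_independent]. The branch [setT] is a default, never reached for times in
    [iota 0 k]. *)
Lemma history_preimage k h : history k @^-1` [set h] =
  \bigcap_(i in [set` iota 0 k]) (draw i @^-1`
     (if insub i is Some j then [set h j] else setT)).
Proof.
apply/seteqP; split => [w /= <- i|w hw].
  by rewrite /= mem_iota => /= ik; rewrite insubT//= ffunE.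
apply/ffunP => i; rewrite ffunE.
by have := hw i; rewrite /= mem_iota ltn_ord valK => /(_ isT).
Qed.

End Histories.

(** * Independence of the past from the current draw *)

Section Draws.
Context {R : realType} {Nb : nat} {disp : measure_display}.
Context {T : measurableType disp}.
Variables (P : probability T R) (B : nat) (draw : nat -> T -> {set 'I_Nb}).
Hypothesis draw_unif : uniform_draws P B draw.

Lemma measurable_draw k : measurable_fibers (draw k).
Proof. by case: draw_unif => mdraw _ _ S; exact: mdraw. Qed.

Lemma measurable_history k : measurable_fibers (history draw k).
Proof.
move=> h; rewrite history_preimage; apply: fin_bigcap_measurable => // i _.
by case: insubP => [j _ _|_]; [exact: measurable_draw|rewrite preimage_setT].
Qed.

(** The joint event is a single intersection over the times 0 to [k], so the product rule applies
    both to it and to its restriction to the times below [k]. *)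
Lemma history_draw_independent k h S :
  P (history draw k @^-1` [set h] `&` draw k @^-1` [set S]) =
  (P (history draw k @^-1` [set h]) * P (draw k @^-1` [set S]))%E.
Proof.
have [_ _ indep] := draw_unif.
pose A i : set {set 'I_Nb} := if insub i is Some j then [set h j] else setT.
pose A' i := if i == k then [set S] else A i.
have A'E i : (i \in iota 0 k) -> A' i = A i.
  by rewrite mem_iota /A' => ik; rewrite ltn_eqF.
rewrite history_preimage -/A.
pose J := rcons (iota 0 k) k.
have -> : (\bigcap_(i in [set` iota 0 k]) (draw i @^-1` A i) `&` draw k @^-1` [set S]
   = \bigcap_(i in [set` J]) (draw i @^-1` A' i)).
  apply/seteqP; split => w.
    move=> [hw Sw] i /=; rewrite mem_rcons inE => /orP[/eqP->|ik].
      by rewrite /A' eqxx.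
    by rewrite A'E//; exact: hw.
  move=> hw; split => [i /= ik|].
    by rewrite -A'E//; apply: hw; rewrite /= mem_rcons inE ik orbT.
  by have := hw k; rewrite /= mem_rcons mem_head /A' eqxx; exact.
rewrite !indep ?rcons_uniq ?mem_iota ?iota_uniq ?add0n ?ltnn//.
rewrite big_rcons/= {2}/A' eqxx.
congr (_ * _)%E; apply: eq_big_seq => i ik.
by rewrite A'E.
Qed.

Lemma integrable_adapted k (X : T -> R) :
  adapted draw k X -> P.-integrable setT (EFin \o X).
Proof.
move=> /adapted_history[F ->]; apply: integrable_finitely_valued.
exact: measurable_history.
Qed.

Lemma integrable_adapted_draw k (X : T -> R) (G : {set 'I_Nb} -> R) :
  adapted draw k X -> P.-integrable setT (EFin \o (fun w => X w * G (draw k w))).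
Proof.
move=> aX; apply: (@integrable_adapted k.+1) => w w' ww'.
by rewrite ww'// (aX w w')// => i ik; rewrite ww'// ltnS ltnW.
Qed.

Lemma Rintegral_draw k (G : {set 'I_Nb} -> R) :
  \int[P]_w G (draw k w) = ('C(Nb, B))%:R^-1 * \sum_(S : {set 'I_Nb} | #|S| == B) G S.
Proof.
have [_ Pdraw _] := draw_unif.
rewrite Rintegral_finitely_valued; last exact: measurable_draw.
rewrite mulr_sumr [RHS]big_mkcond; apply: eq_bigr => S _.
by rewrite Pdraw; case: ifP => _ /=; rewrite ?mulr0// mulrC.
Qed.

(** An adapted factor depends on the history alone, so its expectation separates from the average of
    [G] over the sets of size [B]. *)
Lemma Rintegral_adapted_draw k (X : T -> R) (G : {set 'I_Nb} -> R) :
  adapted draw k X ->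
  \int[P]_w (X w * G (draw k w)) =
  (\int[P]_w X w) * (('C(Nb, B))%:R^-1 * \sum_(S : {set 'I_Nb} | #|S| == B) G S).
Proof.
move=> /adapted_history[F ->]; rewrite -(Rintegral_draw k).
apply: Rintegral_mul_independent.
- exact: measurable_history.
- exact: measurable_draw.
- exact: history_draw_independent.
Qed.

End Draws.

(** Pascal's rule: the sets of size [k] avoiding [x] are those of its complement, and removing their
    number from the binomial coefficient leaves the sets containing [x]. *)
Lemma card_draws_in (T : finType) (x : T) k : (0 < k)%N ->
  #|[set A : {set T} | (#|A| == k) && (x \in A)]%SET| = 'C(#|T|.-1, k.-1).
Proof.
case: k => // k _; have T0 : (0 < #|T|)%N by apply/card_gt0P; exists x.
have := card_draws T k.+1; rewrite -[#|T|](prednK T0) binS.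
rewrite -(cardsID [set A : {set T} | x \in A]%SET).
rewrite (_ : (_ :&: _)%SET =
    [set A : {set T} | (#|A| == k.+1) && (x \in A)]%SET); last first.
  by apply/setP => A; rewrite !inE.
rewrite (_ : (_ :\: _)%SET =
    [set A : {set T} | A \subset ~: [set x]%SET & #|A| == k.+1]%SET); last first.
  apply/setP => A; rewrite !inE -[A \subset _]finset.setCS finset.setCK.
  by rewrite finset.sub1set inE andbC.
by rewrite cards_draws cardsC1 addnC => /addnI.
Qed.

(** * Adaptedness and feasibility of the iterates *)

Section FrankWolfe.
Context (R : realType) (Nb B : nat) (d : 'I_Nb -> nat).
Context (Xb : forall n : 'I_Nb, set 'rV[R]_(d n)).
Context (f : 'rV[R]_(\sum_(n < Nb) d n) -> R) (gamma : nat -> R).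
Context (T : Type) (draw : nat -> T -> {set 'I_Nb}).
Context (x0 : 'rV[R]_(\sum_(n < Nb) d n)).
Context (s : nat -> T -> forall n : 'I_Nb, 'rV[R]_(d n)).
Context (x : nat -> T -> 'rV[R]_(\sum_(n < Nb) d n)).
Hypothesis x_FW : randomized_block_FW Xb f gamma x0 draw s x.

(** By induction: [x k.+1] is computed from [x k], draw [k] and the minimizers of the drawn blocks,
    which are functions of the draws up to [k]. *)
Lemma iterate_adapted k : adapted draw k (x k).
Proof.
have [x0E _ s_adapted xS] := x_FW.
elim: k => [w w' _|k IH w w' ww']; first by rewrite !x0E.
rewrite !xS ww'// (IH w w') => [|i ik]; last by rewrite ww'// ltnS ltnW.
by apply: eq_block_step => n nS; apply: s_adapted => //; rewrite ww'.
Qed.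

Lemma iterate_feasible k w : (forall n, convex_set (@Xb n)) ->
  (forall k, 0 < gamma k <= 1) -> feasible Xb x0 -> feasible Xb (x k w).
Proof.
have [x0E s_argmin _ xS] := x_FW.
move=> cX gamma01 Xx0; elim: k => [|k IH]; first by rewrite x0E.
rewrite xS; apply: block_step_feasible => //.
  by have /andP[/ltW-> ->] := gamma01 k.
by move=> n nS; have [] := s_argmin k w n nS.
Qed.

End FrankWolfe.

Lemma expected_curvatureE (R : realType) (Nb B : nat) (d : 'I_Nb -> nat)
    (Xb : forall n : 'I_Nb, set 'rV[R]_(d n))
    (f : 'rV[R]_(\sum_(n < Nb) d n) -> R) :
  (forall S, set_curvature Xb f S \is a fin_num) ->
  expected_curvature Xb f B = (('C(Nb, B))%:R^-1 *
    \sum_(S : {set 'I_Nb} | #|S| == B) fine (set_curvature Xb f S))%:E.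
Proof.
move=> Cfin; rewrite /expected_curvature EFinM -sumEFin; congr (_ * _)%E.
by apply: eq_bigr => S _; rewrite fineK.
Qed.

(** The probability that a uniform set of size [B] contains a given block is ['C(Nb.-1, B.-1)] over
    ['C(Nb, B)]. *)
Lemma uniform_draw_mem (R : realType) (Nb B : nat) (n : 'I_Nb) : (0 < B <= Nb)%N ->
  ('C(Nb, B))%:R^-1 * \sum_(S : {set 'I_Nb} | #|S| == B) (n \in S)%:R
  = B%:R / Nb%:R :> R.
Proof.
move=> /andP[B0 BN].
have Nb0 : (Nb%:R : R) != 0 by rewrite pnatr_eq0 -lt0n (leq_trans B0).
have C0 : ('C(Nb, B)%:R : R) != 0 by rewrite pnatr_eq0 -lt0n bin_gt0.
rewrite -natr_sum -big_mkcondr/= sum1dep_card card_draws_in// card_ord.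
(* The absorption identity [Nb * 'C(Nb.-1, B.-1) = B * 'C(Nb, B)] evaluates this quotient. *)
have := mul_bin_diag Nb B.-1; rewrite (prednK B0) => /(congr1 (fun m => m%:R : R)).
rewrite !natrM => H; apply: (mulfI C0); rewrite mulVKf//.
by apply: (mulfI Nb0); rewrite H; field.
Qed.

(** * Descent in expectation over one iteration *)

Section ExpectedDescent.
Context (R : realType) (Nb B : nat) (hB : (0 < B <= Nb)%N) (d : 'I_Nb -> nat).
Context (Xb : forall n : 'I_Nb, set 'rV[R]_(d n)).
Context (f : 'rV[R]_(\sum_(n < Nb) d n) -> R) (gamma : nat -> R).
Context (disp : measure_display) (T : measurableType disp).
Context (P : probability T R) (draw : nat -> T -> {set 'I_Nb}).
Context (x0 : 'rV[R]_(\sum_(n < Nb) d n)).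
Context (s : nat -> T -> forall n : 'I_Nb, 'rV[R]_(d n)).
Context (x : nat -> T -> 'rV[R]_(\sum_(n < Nb) d n)).
Context (lmo : forall n : 'I_Nb, 'rV[R]_(d n) -> 'rV[R]_(d n)).
Hypothesis Xb_convex : forall n, convex_set (@Xb n).
Hypothesis gamma_itv : forall k, 0 < gamma k <= 1.
Hypothesis x0_feasible : feasible Xb x0.
Hypothesis Cfin : forall S, set_curvature Xb f S \is a fin_num.
Hypothesis draw_unif : uniform_draws P B draw.
Hypothesis x_FW : randomized_block_FW Xb f gamma x0 draw s x.
Hypothesis lmoP : linear_oracle Xb (@lmo).

Let adapted_comp (V : Type) k (F : _ -> V) : adapted draw k (fun w => F (x k w)).
Proof. by move=> w w' ww'; rewrite (iterate_adapted x_FW ww'). Qed.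

Lemma integrable_iterate k (F : 'rV[R]_(\sum_(n < Nb) d n) -> R) :
  P.-integrable setT (EFin \o (fun w => F (x k w))).
Proof. exact: (integrable_adapted draw_unif (@adapted_comp _ k F)). Qed.

(** The sum over the random drawn set is written as a sum over all blocks of the adapted gap [G n]
    times the indicator that [n] is drawn, so that independence can be used block by block. *)
Lemma expected_descent k :
  \int[P]_w f (x k.+1 w) <= \int[P]_w f (x k w)
    - B%:R / Nb%:R * gamma k * (\int[P]_w \sum_n block_gap (@lmo) f (x k w) n)
    + gamma k ^+ 2 / 2 * fine (expected_curvature Xb f B).
Proof.
have [_ s_argmin _ xS] := x_FW.
pose G n w := block_gap (@lmo) f (x k w) n.
pose C S := fine (set_curvature Xb f S).
have aG n : adapted draw k (G n) by exact: (adapted_comp (fun y => block_gap _ f y n)).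
have iG n : P.-integrable setT (EFin \o (fun w => G n w * (n \in draw k w)%:R)).
  exact: (integrable_adapted_draw draw_unif (fun S => (n \in S)%:R) (aG n)).
have iC : P.-integrable setT (EFin \o (fun w => C (draw k w))).
  exact: integrable_finitely_valued (measurable_draw draw_unif k).
have iSum : P.-integrable setT
    (EFin \o (fun w => \sum_n G n w * (n \in draw k w)%:R)).
  rewrite (_ : EFin \o _ =
      fun w => (\sum_n (G n w * (n \in draw k w)%:R)%:E)%E); last first.
    by apply/funext => w /=; rewrite sumEFin.
  by apply: integrable_sum => // n _; exact: iG.
have iZ (a : R) X : P.-integrable setT (EFin \o X) ->
    P.-integrable setT (EFin \o (fun w => a * X w)).
  by move=> iX; exact: (integrableZl measurableT a iX).
have step w : f (x k.+1 w) <=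
    f (x k w) - gamma k * (\sum_n G n w * (n \in draw k w)%:R)
    + gamma k ^+ 2 / 2 * C (draw k w).
  rewrite xS; apply: le_trans (block_step_descent _ _ _ (Cfin _)) _ => //.
  - exact: (iterate_feasible x_FW).
  - by move=> n nS; have [] := s_argmin k w n nS.
  - rewrite lerD2r lerD2l lerN2 [in leRHS]big_mkcond/= le_eqVlt.
    apply/orP; left; apply/eqP.
    congr (_ * _); apply: eq_bigr => n _; case: ifPn => nS; rewrite ?mulr0// mulr1.
    by rewrite (block_gap_argmin lmoP (s_argmin k w n nS)).
have iB : P.-integrable setT (EFin \o
    (fun w => f (x k w) - gamma k * (\sum_n G n w * (n \in draw k w)%:R))).
  exact: (integrableB measurableT (integrable_iterate k f) (iZ _ _ iSum)).
apply: (le_trans (le_Rintegral measurableT (integrable_iterate k.+1 f) _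
  (fun w _ => step w))).
  exact: (integrableD measurableT iB (iZ _ _ iC)).
rewrite RintegralD//; last exact: iZ.
rewrite RintegralB//; [|exact: integrable_iterate|exact: iZ].
rewrite (RintegralZl _ _ iSum)// (RintegralZl _ _ iC)// (Rintegral_sum iG).
rewrite (Rintegral_draw draw_unif k C).
rewrite expected_curvatureE//= Rintegral_sum; last first.
  by move=> n; exact: (integrable_adapted draw_unif (aG n)).
rewrite lerD2r lerD2l lerN2 [_ * gamma k]mulrC -mulrA.
rewrite le_eqVlt; apply/orP; left; apply/eqP; congr (_ * _).
rewrite mulr_sumr; apply: eq_bigr => n _.
(* The expected indicator separates from the gap and equals [B%:R / Nb%:R]. *)
rewrite (Rintegral_adapted_draw draw_unif (fun S => (n \in S)%:R) (aG n)).
by rewrite uniform_draw_mem// mulrC.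
Qed.

End ExpectedDescent.

(** * Summation of the expected descent from [K] to [t] *)

Theorem theorem2 (R : realType) (Nb B : nat) (hB : (0 < B <= Nb)%N)
    (d : 'I_Nb -> nat) (Xb : forall n : 'I_Nb, set 'rV[R]_(d n))
    (Xb_neq0 : forall n, Xb n !=set0)
    (Xb_convex : forall n, convex_set (Xb n))
    (Xb_compact : forall n, compact (Xb n))
    (f : 'rV[R]_(\sum_(n < Nb) d n) -> R)
    (U : set 'rV[R]_(\sum_(n < Nb) d n))
    (U_open : open U) (XU : feasible Xb `<=` U)
    (f_diff : forall x, U x -> differentiable (f : _ -> R^o) x)
    (f_convex : convex_function (feasible Xb) (f : _ -> R^o))
    (xstar : 'rV[R]_(\sum_(n < Nb) d n))
    (xstar_min : is_argmin (feasible Xb) f xstar)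
    (Cf_fin : set_curvature Xb f [set: 'I_Nb]%SET \is a fin_num)
    (gamma : nat -> R)
    (gamma_itv : forall t, 0 < gamma t <= 1)
    (gamma_rec : forall t,
       (1 - B%:R / Nb%:R * gamma t.+1) / gamma t.+1 ^+ 2 <= 1 / gamma t ^+ 2)
    (gamma_noninc : forall t, gamma t.+1 <= gamma t)
    (disp : measure_display) (Omega : measurableType disp)
    (P : probability Omega R)
    (draw : nat -> Omega -> {set 'I_Nb})
    (draw_unif : uniform_draws P B draw)
    (x0 : 'rV[R]_(\sum_(n < Nb) d n)) (x0_feasible : feasible Xb x0)
    (s : nat -> Omega -> forall n : 'I_Nb, 'rV[R]_(d n))
    (x : nat -> Omega -> 'rV[R]_(\sum_(n < Nb) d n))
    (x_FW : randomized_block_FW Xb f gamma x0 draw s x)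
    (t K : nat) (ht : (1 <= t)%N) (hK : (1 <= K <= t)%N) :
  let alpha : R := B%:R / Nb%:R in
  (\big[Order.min/+oo]_(k < t.+1)
      'E_P[fun w => duality_gap Xb f (x k w)]
   <= 'E_P[fun w => (f (x K w) - f xstar)%R]
        * ((alpha * (t - K + 1)%:R * gamma t)^-1)%:E
      + expected_curvature Xb f B
        * (gamma K ^+ 2 / (2 * alpha * gamma t))%:E)%E.
Proof.
have x_feasible k w : feasible Xb (x k w) by exact: (iterate_feasible x_FW).
have Cfin S : set_curvature Xb f S \is a fin_num.
  exact: set_curvature_fin_num x0_feasible Cf_fin.
have [lmo lmoP] : exists lmo, linear_oracle Xb lmo.
  have lmin n v : {u | is_argmin (Xb n) (fun u => inner u v) u}.
    exact/cid/linear_argmin_exists.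
  by exists (fun n v => projT1 (lmin n v)) => n v; exact: projT2 (lmin n v).
cbv zeta; set alpha : R := B%:R / Nb%:R.
pose C := fine (expected_curvature Xb f B).
pose F k : R := \int[P]_w f (x k w).
pose G k : R := \int[P]_w \sum_n block_gap lmo f (x k w) n.
have [/andP[B0 BN] /andP[K1 Kt]] := (hB, hK).
have alpha0 : 0 < alpha by rewrite divr_gt0// ltr0n// (leq_trans B0).
have gamma0 k : 0 < gamma k by have /andP[] := gamma_itv k.
have gamma_le i j : (i <= j)%N -> gamma j <= gamma i.
  by move: i j; apply: (nonincreasing_seqP gamma).1.
have CE : expected_curvature Xb f B = C%:E.
  by rewrite /C expected_curvatureE.
have C0 : 0 <= C.
  rewrite -lee_fin -CE mule_ge0 ?lee_fin ?invr_ge0//.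
  by apply: sume_ge0 => S _; exact: set_curvature_ge0 x0_feasible.
have G0 k : 0 <= G k.
  apply: Rintegral_ge0 => w _; apply: sumr_ge0 => n _.
  exact: block_gap_ge0 lmoP (x_feasible k w).
have FhE k : \int[P]_w (f (x k w) - f xstar) = F k - f xstar.
  rewrite RintegralB//; last exact: finite_measure_integrable_cst.
    by rewrite Rintegral_cst// (congr1 fine (probability_setT P)) mulr1.
  exact: (integrable_iterate draw_unif x_FW k f).
have Fstar k : f xstar <= F k.
  rewrite -subr_ge0 -FhE; apply: Rintegral_ge0 => w _; rewrite subr_ge0.
  by have [_] := xstar_min; apply; exact: x_feasible.
rewrite expectation_Rintegral; last first.
  exact: (integrable_iterate draw_unif x_FW K (fun y => f y - f xstar)).
(* By contradiction: if the claimed bound [b] lies strictly below the minimum, it lies below every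
   expected gap, hence below every [G k] with [k <= t]. *)
rewrite CE FhE -!EFinM -EFinD leNgt; apply/negP.
set b := (X in X%:E); set m := \big[_/_]_(_ < _) _ => bm.
have bG k : (k < t.+1)%N -> b < G k.
  move=> kt; rewrite -lte_fin; apply: (lt_le_trans bm).
  apply: (le_trans (bigmin_le _ (Ordinal kt) _)) => /=.
  rewrite expectation_Rintegral; last first.
    exact: (integrable_iterate draw_unif x_FW k (duality_gap Xb f)).
  rewrite lee_fin; apply: le_Rintegral => //.
  - exact: (integrable_iterate draw_unif x_FW k (duality_gap Xb f)).
  - exact: (integrable_iterate draw_unif x_FW k (fun y => \sum_n block_gap lmo f y n)).
  - by move=> w _; exact: duality_gap_le lmoP (x_feasible k w).
have N0 : 0 < (t - K + 1)%:R :> R by rewrite ltr0n addn1.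
have sumG : \sum_(K <= k < t.+1) alpha * gamma t * G k <=
    F K - f xstar + (t - K + 1)%:R * (gamma K ^+ 2 / 2 * C).
  have termG k : (K <= k < t.+1)%N ->
      alpha * gamma t * G k <= (F k - F k.+1) + gamma K ^+ 2 / 2 * C.
    move=> /andP[Kk kt].
    have := expected_descent hB Xb_convex gamma_itv x0_feasible Cfin draw_unif
      x_FW lmoP k.
    rewrite -/(F k) -/(F k.+1) -/(G k) -/C -/alpha => descent.
    (* Lowering [gamma k] to [gamma t] relies on [G k >= 0]; raising it to [gamma K] in the
       curvature term relies on [C >= 0]. *)
    have : alpha * gamma t * G k <= alpha * gamma k * G k.
      by rewrite ler_wpM2r// ler_wpM2l ?(ltW alpha0)// gamma_le.
    have : gamma k ^+ 2 / 2 * C <= gamma K ^+ 2 / 2 * C.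
      rewrite ler_wpM2r// ler_wpM2r// lerXn2r ?gamma_le//; exact: ltW.
    lra.
  apply: le_trans (ler_sum_nat termG) _.
  rewrite big_split/= sumr_const_nat subSn// addn1 -[_ *+ _]mulr_natl lerD2r.
  (* The differences telescope to [F K - F t.+1], and [F t.+1] is at least the minimum [f xstar]. *)
  rewrite (telescope_sumr_eq (fun k => - F k)) ?leqW// => [|k _].
    by rewrite opprK addrC lerD2l lerN2.
  by rewrite opprK addrC.
have : \sum_(K <= k < t.+1) alpha * gamma t * b < 
    \sum_(K <= k < t.+1) alpha * gamma t * G k.
  (* The range is nonempty since [K <= t], so the inequality stays strict after summation. *)
  apply: ltr_sum_nat => [|k /andP[_ kt]]; first by rewrite ltnS.
  by rewrite (ltr_pM2l (mulr_gt0 alpha0 (gamma0 t))) bG.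
rewrite sumr_const_nat subSn// -[_ *+ _]mulr_natl -[in X in X < _]addn1.
move=> /lt_le_trans/(_ sumG).
(* The bound [b] is exactly the value for which the summed lower bound equals the right-hand side of
   [sumG], so the strict chain is absurd. *)
suff -> : (t - K + 1)%:R * (alpha * gamma t * b) =
    F K - f xstar + (t - K + 1)%:R * (gamma K ^+ 2 / 2 * C) by rewrite ltxx.
by rewrite /b; field; rewrite !gt_eqF//.
Qed.
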